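(* Let $\theta \in \mathcal{P}$, let $L = [\ell_1,\dots,\ell_K]^T$ be an observation operator, and let $\lambda_L^{\theta,1} \ge \dots \ge \lambda_L^{\theta,M} > 0$ be the eigenvalues of the posterior covariance matrix $$\Sigma_{\mathrm{post}}^{L,\theta} = \left( \tfrac{1}{\sigma^2}\, \mathbf{G}_{L,\theta}^T \Sigma_L^{-1} \mathbf{G}_{L,\theta} + \Sigma_{\mathrm{pr}}^{-1}\right)^{-1} \in \mathbb{R}^{M\times M}.$$ Let $\lambda_{\mathrm{pr}}^{\max}$ denote the largest eigenvalue of $\Sigma_{\mathrm{pr}}$. Then for every $m = 1,\dots,M$, $$\lambda_L^{\theta,m} \le \left( \tfrac{1}{\sigma^2}\, \beta_G(\theta)^2 + 1 \right)^{-1} \lambda_{\mathrm{pr}}^{\max}.$$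
   Context: Setting. $\mathcal{X}$ is a real Hilbert space with inner product $\langle\cdot,\cdot\rangle_{\mathcal{X}}$, norm $\|\cdot\|_{\mathcal{X}}$ and dual $\mathcal{X}'$; $\mathcal{P} \subset \mathbb{R}^p$ is a compact set of hyper-parameters (configurations). For each $\theta\in\mathcal{P}$ and each parameter $\mathbf{u}\in\mathbb{R}^M$ there is a state $x_\theta(\mathbf{u})\in\mathcal{X}$; the map $\mathbf{u}\mapsto x_\theta(\mathbf{u})$ is linear. $\Sigma_{\mathrm{pr}}\in\mathbb{R}^{M\times M}$ is a symmetric positive definite (prior covariance) matrix, and $\|\mathbf{u}\|_{\Sigma_{\mathrm{pr}}^{-1}}^2 := \mathbf{u}^T\Sigma_{\mathrm{pr}}^{-1}\mathbf{u}$. The states are uniformly bounded: there is $\bar\eta>0$ with $\overline{\eta}(\theta) := \sup_{\mathbf{u}\neq 0} \|x_\theta(\mathbf{u})\|_{\mathcal{X}} / \|\mathbf{u}\|_{\Sigma_{\mathrm{pr}}^{-1}} < \bar\eta$ for all $\theta\in\mathcal{P}$. Observation operator. $L = [\ell_1,\dots,\ell_K]^T : \mathcal{X}\to\mathbb{R}^K$, $Lx = [\ell_1(x),\dots,\ell_K(x)]^T$, with $\ell_k\in\mathcal{X}'$ distinct elements of a sensor library $\mathcal{L}\subset\mathcal{X}'$. The measurement noise is Gaussian with mean zero and covariance $\sigma^2\Sigma_L$, where $\sigma^2>0$ and $\Sigma_L\in\mathbb{R}^{K\times K}$ is symmetric positive definite. The data norm is $\|\mathbf{d}\|_{\Sigma_L^{-1}}^2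 := \mathbf{d}^T\Sigma_L^{-1}\mathbf{d}$. The matrix $\mathbf{G}_{L,\theta}\in\mathbb{R}^{K\times M}$ represents, in the unit bases, the linear parameter-to-observable map $G_{L,\theta}:\mathbb{R}^M\to\mathbb{R}^K$, $G_{L,\theta}(\mathbf{u}) := L x_\theta(\mathbf{u})$. The observability coefficient is $$\beta_G(\theta) := \inf_{\mathbf{u}\in\mathbb{R}^M\setminus\{0\}} \frac{\|G_{L,\theta}(\mathbf{u})\|_{\Sigma_L^{-1}}}{\|\mathbf{u}\|_{\Sigma_{\mathrm{pr}}^{-1}}}.$$ *)

(* Defs.v *)
From HB Require Import structures.
From mathcomp Require Import all_boot all_order all_algebra.
From mathcomp Require Import all_classical all_reals all_analysis.

Set Implicit Arguments.
Unset Strict Implicit.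
Unset Printing Implicit Defensive.

Import Order.TTheory GRing.Theory Num.Theory.
Import numFieldNormedType.Exports.
Local Open Scope classical_set_scope.
Local Open Scope ring_scope.

(* A complete normed space whose norm comes from the inner product [ip] is a
   Hilbert space; [{dot X for idfun}] is the type of symmetric, bilinear,
   positive definite forms. *)
Definition hilbert_ip (R : realType) (X : completeNormedModType R)
    (ip : {dot X for (idfun : R -> R)}) : Prop :=
  forall x : X, `|x| ^+ 2 = ip x x.

Definition dual_space (R : realType) (X : normedModType R) : set (X -> R) :=
  [set f : X -> R | scalar f /\ continuous f].

Definition spd (R : realType) (n : nat) (A : 'M[R]_n) : Prop :=
  A^T = A /\ forall v : 'cV[R]_n, v != 0 -> 0 < (v^T *m A *m v) 0 0.

(* The norm written ||v||_W, with ||v||_W ^ 2 = v^T W v. *)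
Definition wnorm (R : realType) (n : nat) (W : 'M[R]_n) (v : 'cV[R]_n) : R :=
  Num.sqrt ((v^T *m W *m v) 0 0).

(* Extended-real valued, so that an unbounded ratio gives +oo (the real [sup]
   of an unbounded set is 0). *)
Definition eta_bar (R : realType) (X : normedModType R) (M : nat)
    (Sigma_pr : 'M[R]_M) (x : 'cV[R]_M -> X) : \bar R :=
  ereal_sup [set (`|x u| / wnorm (invmx Sigma_pr) u)%:E | u in [set u | u != 0]].

Definition obs_op (R : realType) (X : normedModType R) (K : nat)
    (l : 'I_K -> X -> R) (y : X) : 'cV[R]_K :=
  \col_k l k y.

Definition pto_map (R : realType) (X : normedModType R) (M K : nat)
    (l : 'I_K -> X -> R) (x : 'cV[R]_M -> X) (u : 'cV[R]_M) : 'cV[R]_K :=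
  obs_op l (x u).

(* The matrix of a linear map in the unit bases: column j is the image of the
   j-th unit vector. *)
Definition unit_basis_mx (R : realType) (M K : nat)
    (f : 'cV[R]_M -> 'cV[R]_K) : 'M[R]_(K, M) :=
  \matrix_(k < K, j < M) f (delta_mx j 0) k 0.

Definition observability_coef (R : realType) (M K : nat) (Sigma_pr : 'M[R]_M)
    (Sigma_L : 'M[R]_K) (G : 'cV[R]_M -> 'cV[R]_K) : R :=
  inf [set wnorm (invmx Sigma_L) (G u) / wnorm (invmx Sigma_pr) u
      | u in [set u : 'cV[R]_M | u != 0]].

Definition post_cov (R : realType) (M K : nat) (sigma : R)
    (Sigma_pr : 'M[R]_M) (Sigma_L : 'M[R]_K) (G : 'M[R]_(K, M)) : 'M[R]_M :=
  invmx ((sigma ^+ 2)^-1 *: (G^T *m invmx Sigma_L *m G) + invmx Sigma_pr).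

(* [lam] lists the eigenvalues of [A], repeated according to multiplicity,
   in nonincreasing order. *)
Definition ordered_eigenvalues (R : realType) (n : nat) (A : 'M[R]_n)
    (lam : 'I_n -> R) : Prop :=
  char_poly A = \prod_(i < n) ('X - (lam i)%:P) /\
  forall i j : 'I_n, (i <= j)%N -> lam j <= lam i.

Definition largest_eigenvalue (R : realType) (n : nat) (A : 'M[R]_n) (a : R)
    : Prop :=
  eigenvalue A a /\ forall b : R, eigenvalue A b -> b <= a.

(* Main.v *)
Require Import Defs.
From HB Require Import structures.
From mathcomp Require Import all_boot all_order all_algebra.
From mathcomp Require Import all_classical all_reals all_analysis.
From mathcomp Require Import lra.
Import Order.TTheory GRing.Theory Num.Theory.
Import numFieldNormedType.Exports.
Local Open Scope classical_set_scope.
Local Open Scope ring_scope.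

Set Implicit Arguments.
Unset Strict Implicit.
Unset Printing Implicit Defensive.

(** Every eigenvalue [lambda] of the posterior covariance [invmx H] is a
    reciprocal Rayleigh quotient of the precision matrix
    [H = sigma^-2 G^T Sigma_L^-1 G + Sigma_pr^-1]: a corresponding eigenvector
    [v] satisfies [v^T v = lambda * v^T H v] ([spd_invmx_eigen]).  By the
    definition of the observability coefficient [beta] as an infimum,
    [v^T H v >= (sigma^-2 beta^2 + 1) * v^T Sigma_pr^-1 v]
    ([observability_coef_le]), and [v^T v <= lam_pr_max * v^T Sigma_pr^-1 v]
    ([spd_le_largest_eigenvalue]).  Dividing gives the bound.

    The last inequality is the only spectral fact involved.  It follows from
    the existence of an eigenvalue of a nonempty real symmetric matrix [A] below its
    whole Rayleigh quotient ([symmetric_min_eigenvalue]), applied to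
    [Sigma_pr^-1].  That eigenvalue is the largest [mu] with [A - mu I]
    positive semidefinite: were [A - mu I] invertible, it would be bounded below
    by a positive multiple of the identity ([psd_unitmx_coercive]), and [mu]
    could be increased. *)

(** * Bilinear forms of real matrices *)

Definition bform {R : realType} {m n : nat} (A : 'M[R]_(m, n))
    (u : 'cV[R]_m) (v : 'cV[R]_n) : R := (u^T *m A *m v) 0 0.

Lemma bformBl (R : realType) (m n : nat) (A : 'M[R]_(m, n)) u1 u2 v :
  bform A (u1 - u2) v = bform A u1 v - bform A u2 v.
Proof. by rewrite /bform linearB /= !mulmxBl !mxE. Qed.

Lemma bformBr (R : realType) (m n : nat) (A : 'M[R]_(m, n)) u v1 v2 :
  bform A u (v1 - v2) = bform A u v1 - bform A u v2.
Proof. by rewrite /bform mulmxBr !mxE. Qed.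

Lemma bformZl (R : realType) (m n : nat) (A : 'M[R]_(m, n)) a u v :
  bform A (a *: u) v = a * bform A u v.
Proof. by rewrite /bform linearZ /= -!scalemxAl !mxE. Qed.

Lemma bformZr (R : realType) (m n : nat) (A : 'M[R]_(m, n)) a u v :
  bform A u (a *: v) = a * bform A u v.
Proof. by rewrite /bform -scalemxAr !mxE. Qed.

Lemma bformDm (R : realType) (m n : nat) (A B : 'M[R]_(m, n)) u v :
  bform (A + B) u v = bform A u v + bform B u v.
Proof. by rewrite /bform mulmxDr mulmxDl !mxE. Qed.

Lemma bformZm (R : realType) (m n : nat) a (A : 'M[R]_(m, n)) u v :
  bform (a *: A) u v = a * bform A u v.
Proof. by rewrite /bform -scalemxAr -scalemxAl !mxE. Qed.

Lemma bform_scalar (R : realType) (n : nat) (a : R) (u v : 'cV[R]_n) :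
  bform a%:M u v = a * bform 1%:M u v.
Proof. by rewrite -[a%:M]scalemx1 bformZm. Qed.

Lemma bform_mulr (R : realType) (m n p : nat) (A : 'M[R]_(m, n))
    (B : 'M[R]_(n, p)) u v :
  bform A u (B *m v) = bform (A *m B) u v.
Proof. by rewrite /bform !mulmxA. Qed.

Lemma bform_mull (R : realType) (m n p : nat) (A : 'M[R]_(m, n))
    (B : 'M[R]_(m, p)) u v :
  bform A (B *m u) v = bform (B^T *m A) u v.
Proof. by rewrite /bform trmx_mul !mulmxA. Qed.

Lemma bform1E (R : realType) (n : nat) (v : 'cV[R]_n) :
  bform 1%:M v v = \sum_i v i 0 ^+ 2.
Proof.
by rewrite /bform mulmx1 mxE; apply: eq_bigr => i _; rewrite mxE expr2.
Qed.

Lemma bform1_gt0 (R : realType) (n : nat) (v : 'cV[R]_n) :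
  v != 0 -> 0 < bform 1%:M v v.
Proof.
move=> v0; rewrite bform1E lt0r sumr_ge0 ?andbT; last by move=> i _; exact: sqr_ge0.
apply: contra v0; rewrite psumr_eq0 => [/allP h|i _]; last exact: sqr_ge0.
apply/eqP/matrixP => i j; rewrite ord1 mxE; apply/eqP.
by rewrite -sqrf_eq0; apply: (implyP (h i _)); rewrite ?mem_index_enum.
Qed.

Lemma bform1_ge0 (R : realType) (n : nat) (v : 'cV[R]_n) : 0 <= bform 1%:M v v.
Proof. by rewrite bform1E sumr_ge0 // => i _; exact: sqr_ge0. Qed.

Lemma bform_bounded (R : realType) (n : nat) (A : 'M[R]_n) :
  exists2 C : R, 0 < C & forall v, `|bform A v v| <= C * bform 1%:M v v.
Proof.
exists (1 + \sum_j \sum_i `|A i j|).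
  by rewrite ltr_wpDr // sumr_ge0 // => j _; rewrite sumr_ge0.
move=> v; rewrite mulrDl mul1r ler_wpDl ?bform1_ge0 //.
have le_sq i : v i 0 ^+ 2 <= bform 1%:M v v.
  rewrite bform1E (bigD1 i) //= lerDl sumr_ge0 // => k _; exact: sqr_ge0.
rewrite {1}/bform mxE (le_trans (ler_norm_sum _ _ _)) // mulr_suml.
apply: ler_sum => j _; rewrite mxE mulr_suml mulr_suml.
apply: le_trans (ler_norm_sum _ _ _) _; apply: ler_sum => i _.
rewrite mxE mulrAC normrM mulrC ler_wpM2l //.
have := le_sq i; have := le_sq j; rewrite ler_norml => hj hi.
have := sqr_ge0 (v i 0 - v j 0); have := sqr_ge0 (v i 0 + v j 0).
by rewrite sqrrD sqrrB => h1 h2; apply/andP; split; lra.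
Qed.

(** * The smallest eigenvalue of a symmetric matrix *)

(** Expanding [0 <= bform B (v - t u) (v - t u)] with [u = B^-1 v] gives
    [bform B v v >= 2 t |v|^2 - t^2 bform B^-1 v v]; the second term is at most
    [t^2 C |v|^2] for a constant [C], and [t = 1 / C] makes the right-hand side
    [|v|^2 / C]. *)
Lemma psd_unitmx_coercive (R : realType) (n : nat) (B : 'M[R]_n) :
  B^T = B -> (forall v, 0 <= bform B v v) -> B \in unitmx ->
  exists2 c : R, 0 < c & forall v, c * bform 1%:M v v <= bform B v v.
Proof.
move=> Bsym Bpsd Bunit; have [C C0 leC] := bform_bounded (invmx B).
exists C^-1 => [|v]; first by rewrite invr_gt0.
have := Bpsd (v - C^-1 *: (invmx B *m v)).
rewrite !(bformBl, bformBr, bformZl, bformZr) !bform_mulr !bform_mull mulmxV //.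
rewrite trmx_inv Bsym mulVmx // mulmx1 => h.
have := le_trans (ler_norm _) (leC v).
set q := bform (invmx B) v v in h *; set N := bform 1%:M v v in h *.
move=> qN; have : C^-1 * (C^-1 * q) <= C^-1 * N.
  rewrite ler_pM2l ?invr_gt0 // mulrC ler_pdivrMr // mulrC; lra.
lra.
Qed.

Lemma symmetric_min_eigenvalue (R : realType) (n : nat) (A : 'M[R]_n.+1) :
  A^T = A ->
  exists2 mu : R, eigenvalue A mu & forall v, mu * bform 1%:M v v <= bform A v v.
Proof.
move=> Asym.
pose S := [set c : R | forall v, c * bform 1%:M v v <= bform A v v].
have [C C0 leC] := bform_bounded A.
have SC : S (- C).
  by move=> v; have := leC v; rewrite ler_norml mulNr => /andP[].
pose e : 'cV[R]_n.+1 := delta_mx 0 0.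
have e0 : e != 0.
  by apply/eqP => /matrixP/(_ 0 0)/eqP; rewrite !mxE !eqxx oner_eq0.
have supS : has_sup S.
  split; first by exists (- C).
  exists (bform A e e / bform 1%:M e e) => c Sc.
  by rewrite ler_pdivlMr ?bform1_gt0.
have Smu : S (sup S).
  move=> v; have [->|v0] := eqVneq v 0.
    by rewrite /bform !mulmx0 !mxE mulr0.
  rewrite -ler_pdivlMr ?bform1_gt0 //; apply: ge_sup; first by exists (- C).
  by move=> c Sc; rewrite ler_pdivlMr ?bform1_gt0.
exists (sup S) => //.
set mu := sup S in Smu *; pose B := A - mu%:M.
have BE v : bform B v v = bform A v v - mu * bform 1%:M v v.
  by rewrite /B -scaleN1r bformDm bformZm bform_scalar mulN1r.
have [Bunit|Bsing] := boolP (B \in unitmx).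
  have Bsym : B^T = B by rewrite /B linearB /= Asym tr_scalar_mx.
  have Bpsd v : 0 <= bform B v v by rewrite BE subr_ge0; exact: Smu.
  have [c c0 hc] := psd_unitmx_coercive Bsym Bpsd Bunit.
  have Sc : S (mu + c).
    by move=> v; have := hc v; rewrite BE mulrDl; lra.
  by have := ub_le_sup (proj2 supS) Sc; rewrite -/mu; lra.
move: Bsing; rewrite unitmxE unitfE negbK => /det0P[v v0 vB].
apply/eigenvalueP; exists v => //; apply/eqP.
by rewrite -subr_eq0 -mul_mx_scalar -mulmxBr vB.
Qed.

(** * Symmetric positive definite matrices *)

Lemma spd_unitmx (R : realType) (n : nat) (A : 'M[R]_n) : spd A -> A \in unitmx.
Proof.
move=> [_ Apos]; rewrite unitmxE unitfE; apply/det0P => -[v v0 vA].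
by have := Apos v^T; rewrite trmx_eq0 trmxK vA mul0mx mxE ltxx => /(_ v0).
Qed.

Lemma spd_invmx (R : realType) (n : nat) (A : 'M[R]_n) :
  spd A -> spd (invmx A).
Proof.
move=> spdA; have Aunit := spd_unitmx spdA; have [Asym Apos] := spdA.
have AVsym : (invmx A)^T = invmx A by rewrite trmx_inv Asym.
split=> // v v0; rewrite -/(bform _ v v).
have -> : bform (invmx A) v v = bform A (invmx A *m v) (invmx A *m v).
  by rewrite bform_mulr bform_mull AVsym mulmxA mulVmx // mul1mx.
apply: Apos; apply: contra v0 => /eqP v0.
by rewrite -[v](mulKVmx Aunit) v0 mulmx0.
Qed.

Lemma spd_bform_ge0 (R : realType) (n : nat) (A : 'M[R]_n) v :
  spd A -> 0 <= bform A v v.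
Proof.
move=> [_ Apos]; have [->|/Apos/ltW//] := eqVneq v 0.
by rewrite /bform mulmx0 mxE.
Qed.

Lemma spd_wnorm_sqr (R : realType) (n : nat) (A : 'M[R]_n) v :
  spd A -> wnorm A v ^+ 2 = bform A v v.
Proof. by move=> spdA; rewrite sqr_sqrtr //; exact: spd_bform_ge0. Qed.

Lemma spd_wnorm_gt0 (R : realType) (n : nat) (A : 'M[R]_n) v :
  spd A -> v != 0 -> 0 < wnorm A v.
Proof. by move=> [_ Apos] /Apos; rewrite /wnorm sqrtr_gt0. Qed.

Lemma invmx_eigen (R : realType) (n : nat) (A : 'M[R]_n) (a : R) :
  A \in unitmx -> eigenvalue (invmx A) a ->
  exists2 v : 'rV[R]_n, v != 0 & v = a *: (v *m A).
Proof.
move=> Aunit /eigenvalueP[v vA v0]; exists v => //.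
by rewrite scalemxAl -vA mulmxKV.
Qed.

Lemma spd_invmx_eigen (R : realType) (n : nat) (A : 'M[R]_n) (a : R) :
  spd A -> eigenvalue (invmx A) a ->
  exists2 v : 'cV[R]_n, v != 0 & bform 1%:M v v = a * bform A v v.
Proof.
move=> spdA /(invmx_eigen (spd_unitmx spdA))[w w0 wE].
exists w^T; first by rewrite trmx_eq0.
by rewrite /bform trmxK mulmx1 {1}wE -scalemxAl mxE.
Qed.

Lemma spd_invmx_eigenvalue_gt0 (R : realType) (n : nat) (A : 'M[R]_n) (a : R) :
  spd A -> eigenvalue (invmx A) a -> 0 < a.
Proof.
move=> spdA /(spd_invmx_eigen spdA)[v v0 vE].
by have := bform1_gt0 v0; rewrite vE pmulr_lgt0 //; exact: (proj2 spdA).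
Qed.

(** The smallest eigenvalue of [invmx S] is the reciprocal of an eigenvalue of
    [S], hence at least [a^-1]. *)
Lemma spd_le_largest_eigenvalue (R : realType) (n : nat) (S : 'M[R]_n) (a : R) v :
  spd S -> largest_eigenvalue S a ->
  bform 1%:M v v <= a * bform (invmx S) v v.
Proof.
case: n S v => [|n] S v spdS [_ amax].
  by rewrite bform1E big_ord0 /bform mxE big_ord0 mulr0.
have spdV := spd_invmx spdS; have Sunit := spd_unitmx spdS.
have [mu eig_mu mu_le] := symmetric_min_eigenvalue (proj1 spdV).
have mu0 := spd_invmx_eigenvalue_gt0 spdS eig_mu.
have mua : mu^-1 <= a.
  have [w w0 wE] := invmx_eigen Sunit eig_mu.
  apply: amax; apply/eigenvalueP; exists w => //.
  by rewrite {2}wE scalerA mulVf ?scale1r ?gt_eqF.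
apply: (@le_trans _ _ (mu^-1 * bform (invmx S) v v)).
  by rewrite mulrC ler_pdivlMr // mulrC.
by rewrite ler_wpM2r // spd_bform_ge0.
Qed.

(** * The parameter-to-observable map *)

Lemma unit_basis_mxP (R : realType) (M K : nat) (f : 'cV[R]_M -> 'cV[R]_K) u :
  linear f -> unit_basis_mx f *m u = f u.
Proof.
move=> flin.
pose F : {linear 'cV[R]_M -> 'cV[R]_K} :=
  HB.pack f (GRing.isLinear.Build _ _ _ _ f flin).
rewrite -[f]/(F : _ -> _) {2}[u]matrix_sum_delta linear_sum.
apply/matrixP => k j; rewrite ord1 mxE summxE; apply: eq_bigr => i _.
by rewrite big_ord1 linearZ !mxE mulrC.
Qed.

Lemma pto_map_linear (R : realType) (X : normedModType R) (M K : nat)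
    (l : 'I_K -> X -> R) (x : 'cV[R]_M -> X) :
  (forall k, scalar (l k)) -> linear x -> linear (pto_map l x).
Proof.
move=> llin xlin a u v; apply/matrixP => k j.
by rewrite !mxE xlin llin.
Qed.

Lemma observability_coef_ge0 (R : realType) (M K : nat) (S : 'M[R]_M)
    (T : 'M[R]_K) (G : 'cV[R]_M -> 'cV[R]_K) :
  0 <= observability_coef S T G.
Proof.
rewrite /observability_coef; set E := image _ _.
(* the ratio set is empty when [M = 0], and then its infimum is [0] *)
have [->|/set0P Ene] := eqVneq E set0; first by rewrite inf0.
by apply: lb_le_inf => // _ [u _ <-]; rewrite divr_ge0 // sqrtr_ge0.
Qed.

Lemma observability_coef_le (R : realType) (M K : nat) (S : 'M[R]_M)
    (T : 'M[R]_K) (G : 'cV[R]_M -> 'cV[R]_K) u :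
  spd S -> spd T -> u != 0 ->
  observability_coef S T G ^+ 2 * bform (invmx S) u u
    <= bform (invmx T) (G u) (G u).
Proof.
move=> /spd_invmx spdS /spd_invmx spdT u0.
rewrite -!spd_wnorm_sqr // -exprMn lerXn2r ?nnegrE ?sqrtr_ge0 //.
  by rewrite mulr_ge0 ?sqrtr_ge0 // observability_coef_ge0.
rewrite -ler_pdivlMr ?spd_wnorm_gt0 //; apply: inf_lbound; last by exists u.
by exists 0 => _ [w _ <-]; rewrite divr_ge0 // sqrtr_ge0.
Qed.

(** * The posterior covariance *)

Lemma bform_precision (R : realType) (M K : nat) (s : R) (S : 'M[R]_M)
    (T : 'M[R]_K) (G : 'M[R]_(K, M)) v :
  bform (s *: (G^T *m T *m G) + S) v v
    = s * bform T (G *m v) (G *m v) + bform S v v.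
Proof. by rewrite bformDm bformZm bform_mulr bform_mull mulmxA. Qed.

Lemma spd_precision (R : realType) (M K : nat) (s : R) (S : 'M[R]_M)
    (T : 'M[R]_K) (G : 'M[R]_(K, M)) :
  0 <= s -> spd S -> spd T -> spd (s *: (G^T *m T *m G) + S).
Proof.
move=> s0 [Ssym Spos] spdT; split.
  by rewrite linearD linearZ /= !trmx_mul trmxK (proj1 spdT) Ssym mulmxA.
move=> v v0; rewrite -/(bform _ v v) bform_precision ltr_wpDl ?Spos //.
by rewrite mulr_ge0 // spd_bform_ge0.
Qed.

Unset Implicit Arguments.
Set Strict Implicit.
Set Printing Implicit Defensive.

Theorem mainTheorem1
  (R : realType)
  (X : completeNormedModType R) (ip : {dot X for (idfun : R -> R)})
  (hX : hilbert_ip ip)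
  (p M K : nat)
  (P : set 'rV[R]_p) (hP : compact P)
  (x : 'rV[R]_p -> 'cV[R]_M -> X)
  (hx : forall theta : 'rV[R]_p, P theta -> linear (x theta))
  (Sigma_pr : 'M[R]_M) (hpr : spd Sigma_pr)
  (etabar : R) (hetabar : 0 < etabar)
  (heta : forall theta : 'rV[R]_p, P theta ->
     (eta_bar Sigma_pr (x theta) < etabar%:E)%E)
  (Lib : set (X -> R)) (hLib : Lib `<=` dual_space (X := X))
  (l : 'I_K -> X -> R) (hlLib : forall k : 'I_K, Lib (l k))
  (hldistinct : injective l)
  (sigma : R) (hsigma : 0 < sigma ^+ 2)
  (Sigma_L : 'M[R]_K) (hL : spd Sigma_L)
  (theta : 'rV[R]_p) (htheta : P theta)
  (lam : 'I_M -> R)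
  (hlam : ordered_eigenvalues
     (post_cov sigma Sigma_pr Sigma_L (unit_basis_mx (pto_map l (x theta)))) lam)
  (lam_pr_max : R) (hprmax : largest_eigenvalue Sigma_pr lam_pr_max) :
  forall m : 'I_M,
    0 < lam m /\
    lam m <= ((sigma ^+ 2)^-1
                * observability_coef Sigma_pr Sigma_L (pto_map l (x theta)) ^+ 2
              + 1)^-1 * lam_pr_max.
Proof.
move=> m; case: hlam => char_lam _.
have glin : linear (pto_map l (x theta)).
  by apply: pto_map_linear (hx _ htheta) => k; case: (hLib _ (hlLib k)).
set g := pto_map l (x theta) in glin char_lam *.
set beta := observability_coef _ _ _.
set s := (sigma ^+ 2)^-1 in char_lam *.
have s0 : 0 <= s by rewrite invr_ge0 ltW.
have spdV := spd_invmx hpr.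
have spdH := spd_precision (unit_basis_mx g) s0 spdV (spd_invmx hL).
have eig : eigenvalue (post_cov sigma Sigma_pr Sigma_L (unit_basis_mx g)) (lam m).
  rewrite eigenvalue_root_char char_lam.
  rewrite -(big_map lam xpredT (fun a => 'X - a%:P)) root_prod_XsubC.
  by rewrite map_f ?mem_index_enum.
have lam0 := spd_invmx_eigenvalue_gt0 spdH eig.
split=> //.
have [v v0 vE] := spd_invmx_eigen spdH eig.
have d0 : 0 < s * beta ^+ 2 + 1 by rewrite ltr_wpDl // mulr_ge0 ?sqr_ge0.
have q0 : 0 < bform (invmx Sigma_pr) v v by exact: (proj2 spdV).
have Hle : (s * beta ^+ 2 + 1) * bform (invmx Sigma_pr) v v
    <= s * bform (invmx Sigma_L) (g v) (g v) + bform (invmx Sigma_pr) v v.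
  rewrite mulrDl mul1r lerD2r -mulrA ler_wpM2l //.
  exact: observability_coef_le.
rewrite mulrC ler_pdivlMr // -(ler_pM2r q0).
apply: le_trans (spd_le_largest_eigenvalue v hpr hprmax).
rewrite vE bform_precision unit_basis_mxP // -mulrA.
by rewrite ler_pM2l.
Qed.
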